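(* Let $\alpha$ be a countable ordinal with finite big Ramsey degrees. Then the ordinal $\alpha \cdot m$ has finite big Ramsey degrees for every integer $m \ge 1$.
   Context: For a chain (linearly ordered set) $C$ and a finite chain $n=\{0<1<\dots<n-1\}$, let $\mathrm{Emb}(n,C)$ be the set of order embeddings $n \hookrightarrow C$. The big Ramsey degree $T(n,C)$ is the least positive integer $t$ such that for every integer $k \ge 2$ and every coloring $\chi : \mathrm{Emb}(n, C) \to k$ there is a $U \subseteq C$ order-isomorphic to $C$ with $|\chi(\mathrm{Emb}(n, U))| \le t$; if no such $t$ exists, $T(n,C)=\infty$. A chain $C$ has finite big Ramsey degrees if $T(n,C)<\infty$ for all integers $n\ge 1$. Here $\alpha\cdot m$ is ordinal multiplication, i.e. $\alpha+\dots+\alpha$ ($m$ times). *)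

(* Defs.v *)
From mathcomp Require Import all_boot all_order.
From mathcomp Require Import boolp classical_sets functions cardinality wochoice.

Set Implicit Arguments.
Unset Strict Implicit.
Unset Printing Implicit Defensive.

Local Open Scope classical_set_scope.
Local Open Scope order_scope.
Local Open Scope card_scope.

Record Emb (n : nat) (d : Order.disp_t) (C : orderType d) := MkEmb {
  emb_fun :> 'I_n -> C;
  emb_mono : {mono emb_fun : i j / i <= j}
}.

(* [Emb(n, U)] for [U] a subset of [C], viewed inside [Emb(n, C)]. *)
Definition Emb_in (n : nat) (d : Order.disp_t) (C : orderType d) (U : set C) :
    set (Emb n C) :=
  [set e | forall i, U (e i)].

Arguments Emb_in n {d C} U.

Definition order_isomorphic_subset (d : Order.disp_t) (C : orderType d)
    (U : set C) : Prop :=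
  exists f : C -> C, {mono f : x y / x <= y} /\ range f = U.

Definition big_ramsey_bound (n : nat) (d : Order.disp_t) (C : orderType d)
    (t : nat) : Prop :=
  (0 < t)%N /\
  forall k : nat, (2 <= k)%N -> forall chi : Emb n C -> 'I_k,
  exists U : set C,
    order_isomorphic_subset U /\ chi @` Emb_in n U #<= `I_t.

(* [None] stands for infinity. *)
Definition big_ramsey_degree (n : nat) (d : Order.disp_t) (C : orderType d) :
    option nat :=
  match pselect (exists t, `[< big_ramsey_bound n C t >]) with
  | left ex_t => Some (ex_minn ex_t)
  | right _ => None
  end.

Definition finite_big_ramsey_degrees (d : Order.disp_t) (C : orderType d) :
    Prop :=
  forall n : nat, (1 <= n)%N -> big_ramsey_degree n C <> None.

Definition countable_ordinal (d : Order.disp_t) (C : orderType d) : Prop :=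
  well_order (<=%O : rel C) /\ countable [set: C].

(* The lexicographic order compares the ['I_m] components first, so this is
   [alpha + ... + alpha], [m] times. *)
Definition ordinal_mul_nat (d : Order.disp_t) (alpha : orderType d) (m : nat) :=
  ('I_m *l alpha)%type.

(* Main.v *)
Require Import Defs.
From mathcomp Require Import all_boot all_order.
From mathcomp Require Import boolp classical_sets functions cardinality.

(** A tuple in [J *l C], with [J] finite, is determined by its [J]-coordinates
    together with the finite set of its [C]-coordinates and the pattern saying
    which of these elements sits at which position.  There are only finitely
    many choices of [J]-coordinates and pattern ("types"), and for each type a
    colouring of tuples of [J *l C] becomes a colouring of subsets of [C] of a
    fixed size.  Shrinking [C] successively for each type, and using the same
    copy of [C] in every fibre, bounds the number of colours by the sum over
    all types of the big Ramsey degrees of [C]. *)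

Set Implicit Arguments.
Unset Strict Implicit.
Unset Printing Implicit Defensive.

Import Order.TTheory.

Local Open Scope classical_set_scope.
Local Open Scope order_scope.
Local Open Scope card_scope.

Lemma card_le_setU (T : Type) (A B : set T) (a b : nat) :
  A #<= `I_a -> B #<= `I_b -> A `|` B #<= `I_(a + b).
Proof.
move=> /pcard_leP/injfunPex[f f_lt f_inj] /pcard_leP/injfunPex[g g_lt g_inj].
apply/pcard_leP/injfunPex.
(* Values of [g] are shifted by [a], past all values of [f], so points of [A] and points of [B]
   outside [A] cannot collide. *)
pose h x := if pselect (A x) then f x else (a + g x)%N.
exists h => [x ABx|x y /set_mem ABx /set_mem ABy]; rewrite /h /=.
  case: pselect => [Ax|nAx].
    exact: leq_trans (f_lt _ Ax) (leq_addr _ _).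
  by rewrite ltn_add2l; apply: g_lt; case: ABx.
case: pselect => [Ax|nAx]; case: pselect => [Ay|nAy] /=.
- by apply: f_inj; apply: mem_set.
- by move=> fxy; have := f_lt _ Ax; rewrite /= fxy ltnNge leq_addr.
- by move=> fxy; have := f_lt _ Ay; rewrite /= -fxy ltnNge leq_addr.
- move=> /addnI; apply: g_inj; apply: mem_set.
    by case: ABx.
  by case: ABy.
Qed.

Lemma finite_big_ramsey_degreesP (d : Order.disp_t) (C : orderType d) :
  finite_big_ramsey_degrees C <->
  forall n, (1 <= n)%N -> exists t, big_ramsey_bound n C t.
Proof.
split=> finC n n_ge1; have := finC n n_ge1; rewrite /big_ramsey_degree.
  by case: pselect => // -[t /asboolP bound_t] _; exists t.
by case=> t bound_t; case: pselect => // -[]; exists t; apply/asboolP.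
Qed.

Lemma Emb_eq (n : nat) (d : Order.disp_t) (C : orderType d) (e e' : Emb n C) :
  e =1 e' -> e = e'.
Proof.
case: e e' => [e e_mono] [e' e'_mono] /= /funext ee'.
by case: e' / ee' e'_mono => e'_mono; congr MkEmb; exact: Prop_irrelevance.
Qed.

Section composition.
Context (d : Order.disp_t) (C : orderType d) (f : C -> C).
Hypothesis f_mono : {mono f : x y / x <= y}.

Lemma comp_emb_mono (n : nat) (e : Emb n C) :
  {mono (fun i => f (e i)) : i j / i <= j}.
Proof. by move=> i j; rewrite f_mono emb_mono. Qed.

Definition comp_emb (n : nat) (e : Emb n C) : Emb n C :=
  MkEmb (comp_emb_mono e).

(** Reduces colours seen on the copy [range (f \o g)] to those of the colouring pulled back along
    [f], seen on [range g]. *)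
Lemma Emb_in_range_comp (g : C -> C) (n : nat) (e : Emb n C) :
  Emb_in n (range (f \o g)) e ->
  exists2 e', Emb_in n (range g) e' & e = comp_emb e'.
Proof.
move=> e_fg; pose p i := projT1 (cid2 (e_fg i)).
have fgp i : f (g (p i)) = e i by rewrite /p; case: cid2.
have gp_mono : {mono (fun i => g (p i)) : i j / i <= j}.
  by move=> i j; rewrite -f_mono !fgp emb_mono.
exists (MkEmb gp_mono) => [i|]; first by exists (p i).
by apply: Emb_eq => i /=; rewrite fgp.
Qed.

End composition.

(** Induction on [s]: [f] handles the head, then [g] handles the tail for the colourings pulled back
    along [f]. Shrinking further to [range (f \o g)] adds no colours for the head, so the bounds add
    up. *)
Lemma simultaneous_big_ramsey (d : Order.disp_t) (C : orderType d)
    (I : eqType) (s : seq I) (n : I -> nat) :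
  finite_big_ramsey_degrees C -> (forall i, (1 <= n i)%N) ->
  exists t : nat, forall k, (2 <= k)%N ->
  forall chi : forall i, Emb (n i) C -> 'I_k,
  exists2 f : C -> C, {mono f : x y / x <= y} &
    \bigcup_(i in [set` s]) (chi i @` Emb_in (n i) (range f)) #<= `I_t.
Proof.
move=> /finite_big_ramsey_degreesP finC n_ge1.
elim: s => [|i s [t IHs]].
  exists 0%N => k _ chi; exists id => //.
  by rewrite set_nil bigcup_set0 card_ge0.
have [u [_ bound_u]] := finC _ (n_ge1 i).
exists (u + t)%N => k k_ge2 chi.
have [_ [[f [f_mono <-]] chi_f]] := bound_u k k_ge2 (chi i).
have [g g_mono chi_g] := IHs k k_ge2 (fun j e => chi j (comp_emb f_mono e)).
exists (f \o g) => [x y /=|]; first by rewrite f_mono g_mono.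
apply: card_le_trans (card_le_setU chi_f chi_g); apply: subset_card_le.
move=> _ [j /predU1P[->|j_s] [e e_fg <-]].
  by left; exists e => // l; have [x _ <-] := e_fg l; exists (g x).
have [e' e'_g ->] := Emb_in_range_comp f_mono e_fg.
by right; exists j => //; exists e'.
Qed.

(* [s] and [r] live in types depending on [n] only, so that there are finitely
   many of them; the values of [r] are at most [s], so [inord] is harmless. *)
Lemma emb_factorization (n : nat) (d : Order.disp_t) (C : orderType d)
    (b : 'I_n.+1 -> C) :
  exists (s : 'I_n.+1) (r : {ffun 'I_n.+1 -> 'I_n.+1}) (e : Emb s.+1 C),
    (forall i, b i = e (inord (r i))) /\ (forall j, exists i, e j = b i).
Proof.
(* The increasing list of distinct values of [b]: [e] enumerates it, [r i] is the rank of [b i], and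
   [s] is its length minus one. *)
pose l := sort <=%O (undup (codom b)).
have mem_l x : (x \in l) = (x \in codom b) by rewrite mem_sort mem_undup.
have l_sorted : sorted <%O l by rewrite sort_lt_sorted undup_uniq.
have size_l : (size l <= n.+1)%N.
  by rewrite size_sort (leq_trans (size_undup _))// size_codom card_ord.
have size_l_gt0 : (0 < size l)%N.
  by rewrite (leq_ltn_trans (leq0n (index (b ord0) l)))// index_mem mem_l codom_f.
have size_lE : (size l).-1.+1 = size l by rewrite prednK.
have s_lt : ((size l).-1 < n.+1)%N by rewrite size_lE.
have e_mono : {mono (fun j : 'I_(size l).-1.+1 => nth (b ord0) l j) :
    i j / i <= j}.
  by move=> i j; rewrite lt_sorted_leq_nth// inE -[X in (_ < X)%N]size_lE.
have index_lt i : (index (b i) l < size l)%N by rewrite index_mem mem_l codom_f.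
exists (Ordinal s_lt), [ffun i => inord (index (b i) l)], (MkEmb e_mono).
split=> [i|j] /=.
  rewrite ffunE !inordK ?size_lE// ?(leq_trans (index_lt i))//.
  by rewrite nth_index// mem_l codom_f.
have /mem_nth : (j < size l)%N by rewrite -[X in (_ < X)%N]size_lE.
by move=> /(_ (b ord0)); rewrite mem_l => /codomP.
Qed.

Lemma finite_big_ramsey_degrees_lexi (dJ : Order.disp_t) (J : finOrderType dJ)
    (d : Order.disp_t) (C : orderType d) :
  finite_big_ramsey_degrees C -> finite_big_ramsey_degrees (J *l C)%type.
Proof.
move=> finC; apply/finite_big_ramsey_degreesP => -[//|n] _.
(* A type: the number of distinct [C]-coordinates minus one, the [J]-coordinates, the pattern. *)
pose I : finType :=
  ('I_n.+1 * {ffun 'I_n.+1 -> J} * {ffun 'I_n.+1 -> 'I_n.+1})%type.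
have [t bound_t] := @simultaneous_big_ramsey _ C I (enum I)
  (fun i => i.1.1.+1) finC (fun=> isT).
(* The successor makes the bound positive; writing the number of colours as [k.+1] provides the
   colour [ord0]. *)
exists t.+1; split => // -[//|k] k_ge2 chi.
pose lift (i : I) (e : Emb i.1.1.+1 C) (j : 'I_n.+1) : J *l C :=
  (i.1.2 j, e (inord (i.2 j))).
(* A type that does not yield an increasing tuple receives a dummy colour. *)
pose chi' (i : I) (e : Emb i.1.1.+1 C) : 'I_k.+1 :=
  if pselect {mono lift i e : x y / x <= y} is left lift_mono
  then chi (MkEmb lift_mono) else ord0.
have [f f_mono chi'_f] := bound_t _ k_ge2 chi'.
pose F (x : J *l C) : J *l C := (x.1, f x.2).
exists (range F); split.
  by exists F; split=> // x y; rewrite !leEprodlexi /= f_mono.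
apply: card_le_trans (_ : `I_t #<= _); last by rewrite card_le_II.
apply: card_le_trans chi'_f; apply: subset_card_le.
move=> _ [e e_F <-].
(* The colour of [e] is recovered as the [chi']-colour of [e'] at the type of [e]. *)
have [s [r [e' [eE e'E]]]] := emb_factorization (fun j => (e j).2).
pose i : I := (s, [ffun j => (e j).1], r).
have lift_e : lift i e' = e.
  by apply/funext => j; rewrite /lift /= ffunE -eE -surjective_pairing.
exists i; first by rewrite /= mem_enum.
exists e' => [j|].
  have [l ->] := e'E j; have [x _ <-] := e_F l.
  by exists x.2.
rewrite /chi'; case: pselect => [lift_mono|].
  by congr chi; apply: Emb_eq => j /=; rewrite lift_e.
by rewrite lift_e => -[]; exact: emb_mono.
Qed.

Theorem theorem4p4 (d : Order.disp_t) (alpha : orderType d)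
    (alpha_ordinal : countable_ordinal alpha)
    (alpha_finite : finite_big_ramsey_degrees alpha)
    (m : nat) (m_ge1 : (1 <= m)%N) :
  finite_big_ramsey_degrees (ordinal_mul_nat alpha m).
Proof. exact: finite_big_ramsey_degrees_lexi. Qed.
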